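(* Let $\varLambda=\mathrm{diag}(\varLambda_1,\varLambda_2)$ be a block-diagonal $n\times n$ matrix, $n\geq 2$, with square diagonal blocks $\varLambda_j=\varLambda_j(k,\omega)$, $j=1,2$. Let $B(b)$ be an $n\times n$ matrix depending polynomially on the scalar coupling parameter $b$ (its entries may also depend on $k,\omega$). Let $M_k(b)=\varLambda+bB(b)$ be the system matrix of the coupled system, whose dispersion relation is $\det\{M_k(b)\}=0$, and let $G_j=\det\{\varLambda_j\}$ be the dispersion function of the $j$-th subsystem. Then, since $\varLambda$ is block-diagonal, $$\det\{\varLambda\}=\det\{\varLambda_1\}\det\{\varLambda_2\}=G_1G_2,$$ and the determinant expansion $$\det\{\varLambda+bB(b)\}=\det\{\varLambda\}+\sum_{r=1}^{n-1}c_r(b)\,b^{r}+b^{n}\det\{B(b)\}$$ holds, where $$c_r(b)=\sum_{\alpha,\beta\in Q_{n-r,n}}(-1)^{|\alpha|+|\beta|}\det\{\varLambda[\alpha|\beta]\}\det\{B(b)[\alpha^{c}|\beta^{c}]\},\quad 1\leq r\leq n-1.$$ The terms of this expansion other than $\det\{\varLambda\}=G_1G_2$ play the role of $\gamma G_{\mathrm c}$, so that the dispersion relation $\det\{M_k(b)\}=0$ takes the factorized form $G_1G_2=\gamma G_{\mathrm c}$. The coupling parameter $b$ plays the role of the coupling coefficient $\gamma$ in this form: setting $b=0$ decouples the two subsystems and recovers $G_1G_2=0$, while increasing $b$ from zero introduces the interaction term $\gamma G_{\mathrm c}$ that perturbs the product $G_1G_2$ of the bare dispersion functions.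
   Context: $\varLambda_1,\varLambda_2$ are the system matrices of two subsystems, depending on wavenumber (wavevector) $k$ and frequency $\omega$. The factorized form of a dispersion relation of a system of two coupled subsystems is $G_1(k,\omega)G_2(k,\omega)=\gamma G_{\mathrm c}(k,\omega)$, where $G_1,G_2$ are the subsystem dispersion functions, $\gamma$ is called the coupling coefficient and $G_{\mathrm c}$ the coupling function. The identification of the remaining terms with $\gamma G_{\mathrm c}$, and of $b$ with $\gamma$, is a statement of the roles they play; no separate explicit formulas for $\gamma$ and $G_{\mathrm c}$ are asserted. Notation: $Q_{r,n}=\{(i_1,\dots,i_r):1\leq i_1<\cdots<i_r\leq n\}$; for $\alpha=(i_1,\dots,i_r)$, $|\alpha|=i_1+\cdots+i_r$, and $\alpha^{c}$ is the increasing sequence of the elements of $\{1,\dots,n\}\setminus\alpha$; $M[\alpha|\beta]$ is the submatrix of $M$ with row indices from $\alpha$ and column indices from $\beta$. *)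

(* Defs.v *)
From mathcomp Require Import all_boot all_order all_algebra.

Set Implicit Arguments.
Unset Strict Implicit.
Unset Printing Implicit Defensive.

Import GRing.Theory.
Local Open Scope ring_scope.

(* Q_{r,n}.  Indices are 0-based: the index written i in 1..n is here the
   ordinal of value i - 1, see [iweight]. *)
Definition incseq (r n : nat) : Type :=
  {t : r.-tuple 'I_n | sorted ltn (map val t)}.

(* |alpha|, with the shift by one that restores 1-based indices. *)
Definition iweight (r n : nat) (a : incseq r n) : nat :=
  (\sum_(i < r) (tnth (val a) i).+1)%N.

Definition compl_seq (r n : nat) (a : incseq r n) : seq 'I_n :=
  [seq i <- enum 'I_n | i \notin val a].

Lemma size_compl_seq (r n : nat) (a : incseq r n) :
  size (compl_seq a) == (n - r)%N.
Proof.
have ua : uniq (val a).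
  rewrite -(map_inj_uniq val_inj).
  exact: (sorted_uniq ltn_trans ltnn (valP a)).
have -> : size (compl_seq a) = #|[predC val a]|.
  by rewrite cardE /enum_mem size_filter /compl_seq size_filter enumT.
have hc : (r + #|[predC val a]|)%N = n.
  by have := cardC (mem (val a)); rewrite card_ord (card_uniqP ua) size_tuple.
by rewrite -[X in _ == (X - _)%N]hc addKn.
Qed.

Lemma compl_seq_sorted (r n : nat) (a : incseq r n) :
  sorted ltn (map val (compl_seq a)).
Proof.
rewrite sorted_map; apply: sorted_filter.
  by move=> x y z; apply: ltn_trans.
by rewrite -sorted_map val_enum_ord iota_ltn_sorted.
Qed.

(* alpha^c *)
Definition icompl (r n : nat) (a : incseq r n) : incseq (n - r) n :=
  exist _ (Tuple (size_compl_seq a)) (compl_seq_sorted a).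

(* M[alpha|beta] *)
Definition isubmx (R : Type) (n r s : nat) (M : 'M[R]_n)
    (a : incseq r n) (b : incseq s n) : 'M[R]_(r, s) :=
  mxsub (tnth (val a)) (tnth (val b)) M.

(* The coefficient c_r for the pair (L, B).  The sequences alpha^c and beta^c
   have length n - (n - r), which is r when r <= n. *)
Definition expansion_coef (R : comNzRingType) (n : nat) (L B : 'M[R]_n)
    (r : nat) : R :=
  \sum_(a : incseq (n - r) n) \sum_(b : incseq (n - r) n)
    (-1) ^+ (iweight a + iweight b)
      * \det (isubmx L a b) * \det (isubmx B (icompl a) (icompl b)).

Definition polynomial_fun (R : comNzRingType) (f : R -> R) : Prop :=
  exists p : {poly R}, forall x, f x = p.[x].

(* Main.v *)
Require Import Defs.
From mathcomp Require Import all_boot all_order all_algebra.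
From mathcomp Require Import fingroup perm.

(** Expanding every factor of the Leibniz products of det (A + B) splits it into
    a sum, over pairs (S, T) of subsets of 'I_n, of determinants of matrices
    equal to A on S * T, to B on the product of the complements, and 0
    elsewhere.  These vanish unless S and T have the same cardinality; otherwise
    listing S and T before their complements makes the matrix block-diagonal,
    at the cost of the signs of the two listing permutations, which are the
    parities of the weights up to a common constant.  Replacing B by b B gives
    the expansion in powers of b, and its extreme coefficients are read off
    from the cases b = 0 and A = 0. *)

Import GRing.Theory.
Local Open Scope ring_scope.

(** * Parity of shuffle permutations *)

Lemma lift_permP {n : nat} (s : {perm 'I_n.+1}) (i : 'I_n.+1) :
  {t : {perm 'I_n} | s = lift_perm i (s i) t}.
Proof.
(* The default [k] is never reached: [s] is injective, so [s (lift i k)] differs from [s i]. *)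
pose f k := odflt k (unlift (s i) (s (lift i k))).
have fE k : lift (s i) (f k) = s (lift i k).
  rewrite /f; case: unliftP => [j -> //|/perm_inj/eqP].
  by rewrite eq_sym (negPf (neq_lift i k)).
have f_inj : injective f.
  by move=> k l /(congr1 (lift (s i))); rewrite !fE => /perm_inj/lift_inj.
exists (perm f_inj); apply/permP => k.
case: (unliftP i k) => [j ->|->]; last by rewrite lift_perm_id.
by rewrite lift_perm_lift permE fE.
Qed.

(* [s] lists an m-subset in increasing order, then its complement.  Its
   smallest value 0 is taken either at 0 or at m; removing that value gives the
   induction on n. *)
Lemma odd_perm_shuffle {n : nat} (m : nat) (s : {perm 'I_n}) :
    (m <= n)%N ->
    (forall i j : 'I_n, (i < j < m)%N -> (s i < s j)%N) ->
    (forall i j : 'I_n, (m <= i < j)%N -> (s i < s j)%N) ->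
  odd_perm s = odd (\sum_(i < n | (i < m)%N) (s i + i)).
Proof.
elim: n m s => [|n IHn] m s le_mn s_lt s_ge.
  rewrite big_ord0; suff -> : s = 1%g by rewrite odd_perm1.
  by apply/permP; case.
pose k := (s^-1)%g ord0.
have sk : s k = ord0 by rewrite permKV.
clearbody k; have [t st] := lift_permP s k.
rewrite sk in st.
have sl i : s (lift k i) = (t i).+1 :> nat by rewrite st lift_perm_lift.
(* [s] increases on each block, so its least value sits at the head of one of them. *)
have k0m : (k : nat) = 0%N \/ (k : nat) = m.
  have [km|mk] := ltnP k m.
    left; apply/eqP; rewrite -leqn0 leqNgt; apply/negP => k_gt0.
    by have := s_lt ord0 k; rewrite /= k_gt0 km sk => /(_ isT).
  right; apply/eqP; rewrite eqn_leq mk andbT leqNgt; apply/negP => lt_mk.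
  have hm : (m < n.+1)%N by apply: ltn_trans lt_mk _.
  by have := s_ge (Ordinal hm) k; rewrite /= leqnn lt_mk sk => /(_ isT).
have {st} -> : odd_perm s = odd k (+) odd_perm t.
  by rewrite {1}st odd_lift_perm addbF.
have tltE i j : (t i < t j)%N = (s (lift k i) < s (lift k j))%N.
  by rewrite !sl ltnS.
have [km|mk] := ltnP k m.
  have k0 : k = ord0 by apply/val_inj; case: k0m => // km'; rewrite km' ltnn in km.
  subst k; case: m {k0m} le_mn s_lt s_ge km => // m le_mn s_lt s_ge _.
  rewrite (IHn m) // => [|i j hij|i j hij]; first 1 last.
  - by rewrite tltE; apply: s_lt.
  - by rewrite tltE; apply: s_ge.
  rewrite [in RHS](bigD1_ord ord0) //= sk addn0 add0n.
  (* Removing position 0 lowers every remaining value and position by one, which does not affect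
     parity. *)
  rewrite [in RHS](eq_bigr (fun i : 'I_n => (t i + i) + 2)%N); last first.
    by move=> i _; rewrite sl addn2 addSn addnS.
  by rewrite [in RHS]big_split /= [in RHS]oddD big_const_seq iter_addn_0 oddM addbF.
have {k0m}km : (k : nat) = m.
  by case: k0m => // k0; apply/eqP; rewrite eqn_leq mk k0 leq0n.
have le_mn' : (m <= n)%N by rewrite -km -ltnS.
have liftL (i : 'I_n) : (i < m)%N -> lift k i = i :> nat.
  by move=> im; rewrite /= /bump km leqNgt im.
have liftR (i : 'I_n) : (m <= i)%N -> lift k i = i.+1 :> nat.
  by move=> mi; rewrite /= /bump km mi.
have liftm (i : 'I_n) : (lift k i < m)%N = (i < m)%N.
  have [mi|im] := leqP m i; last by rewrite liftL.
  by rewrite liftR // ltnNge (leq_trans mi).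
rewrite (IHn m) // => [|i j /andP[ij jm]|i j /andP[mi ij]]; first 1 last.
- by rewrite tltE; apply: s_lt; rewrite liftm jm !liftL ?ij // (ltn_trans ij).
- have mj := leq_trans mi (ltnW ij).
  by rewrite tltE; apply: s_ge; rewrite !liftR // ltnS ij (leq_trans mi).
rewrite [in RHS]big_mkcond (bigD1_ord k) //= km ltnn add0n -big_mkcond /=.
rewrite [in RHS](eq_bigl (fun i : 'I_n => (i < m)%N)); last first.
  by move=> i; rewrite -liftm /= km.
(* Positions below [m] stay put and only values drop, so the sum changes by [m], matching the sign
   [odd k] with [k = m]. *)
rewrite [in RHS](eq_bigr (fun i : 'I_n => (t i + i) + 1)%N); last first.
  by move=> i im; rewrite sl addSn addn1; have := liftL i im; rewrite /= km => ->.
rewrite [in RHS]big_split /= [in RHS]oddD !(big_ord_narrow le_mn').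
by rewrite big_const_ord iter_addn_0 mul1n addbC.
Qed.

(** * Block-diagonal and permuted determinants *)

(** The size is a variable tied to [m + p] by [e], so that the lemma applies to [m + (n - m) = n]
    without casting matrices. *)
Lemma det_diag_block {R : comNzRingType} {m p n : nat} (e : (m + p)%N = n)
    (M : 'M[R]_n) (A : 'M_m) (D : 'M_p) :
    (forall i j, M (cast_ord e (lshift p i)) (cast_ord e (lshift p j)) = A i j) ->
    (forall i j, M (cast_ord e (rshift m i)) (cast_ord e (rshift m j)) = D i j) ->
    (forall i j, M (cast_ord e (lshift p i)) (cast_ord e (rshift m j)) = 0) ->
    (forall i j, M (cast_ord e (rshift m i)) (cast_ord e (lshift p j)) = 0) ->
  \det M = \det A * \det D.
Proof.
case: n / e M => M hA hD h0 h0'; rewrite -(det_ublock A 0 D); congr (\det _).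
apply/matrixP => i j; rewrite -(splitK i) -(splitK j).
case: (split i) => i'; case: (split j) => j' /=.
- by rewrite block_mxEul -hA !cast_ord_id.
- by rewrite block_mxEur mxE -(h0 i' j') !cast_ord_id.
- by rewrite block_mxEdl mxE -(h0' i' j') !cast_ord_id.
- by rewrite block_mxEdr -hD !cast_ord_id.
Qed.

Lemma det_mxsub_perm {R : comNzRingType} {n : nat} (M : 'M[R]_n)
    (s t : {perm 'I_n}) :
  \det (mxsub s t M) = (-1) ^+ s * (-1) ^+ t * \det M.
Proof.
have -> : mxsub s t M = row_perm s (col_perm t M).
  by apply/matrixP => i j; rewrite !mxE.
rewrite row_permE col_permE !det_mulmx !det_perm odd_permV.
by rewrite [\det M * _]mulrC mulrA.
Qed.

(** * Splitting the determinant of a sum over pairs of subsets *)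

Definition mixed_mx (R : comNzRingType) (n : nat) (A B : 'M[R]_n)
    (S T : {set 'I_n}) : 'M[R]_n :=
  \matrix_(i, j) (if i \in S then (if j \in T then A i j else 0)
                  else (if j \in T then 0 else B i j)).
Arguments mixed_mx {R n}.

(** Some [i] has exactly one of [i \in S] and [s i \in T] true, so the product meets a zero
    block. *)
Lemma prod_mixed_mx0 {R : comNzRingType} {n : nat} (A B : 'M[R]_n)
    (S T : {set 'I_n}) (s : {perm 'I_n}) :
  T != s @: S -> \prod_i mixed_mx A B S T i (s i) = 0.
Proof.
move=> neqT.
have [i hi] : exists i, (s i \in T) != (i \in S).
  apply/existsP; apply: contraR neqT => /existsPn/= h; apply/eqP/setP => j.
  rewrite -[j](permKV s) (mem_imset _ _ perm_inj).
  by apply/eqP; rewrite -[_ == _]negbK h.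
rewrite (bigD1 i) //= mxE.
by case: (i \in S) (s i \in T) hi => [] [] //; rewrite mul0r.
Qed.

Lemma det_mixed_mx0 {R : comNzRingType} {n : nat} (A B : 'M[R]_n)
    (S T : {set 'I_n}) :
  #|T| != #|S| -> \det (mixed_mx A B S T) = 0.
Proof.
move=> neqST; apply: big1 => s _; rewrite prod_mixed_mx0 ?mulr0 //.
by apply: contra neqST => /eqP ->; rewrite card_imset //; apply: perm_inj.
Qed.

Lemma det_addmx_mixed {R : comNzRingType} {n : nat} (A B : 'M[R]_n) :
  \det (A + B) = \sum_S \sum_T \det (mixed_mx A B S T).
Proof.
transitivity (\sum_(s : {perm 'I_n}) \sum_(S : {set 'I_n}) (-1) ^+ s *
    \prod_i (if i \in S then A i (s i) else B i (s i))).
  apply: eq_bigr => s _; rewrite -mulr_sumr -bigA_distr /=; congr (_ * _).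
  by apply: eq_bigr => i _; rewrite mxE.
rewrite exchange_big /=; apply: eq_bigr => S _; rewrite exchange_big /=.
(* For fixed [s] and [S], only [T = s @: S] contributes. *)
apply: eq_bigr => s _; rewrite -mulr_sumr (bigD1 (s @: S)) //=.
rewrite [X in _ = _ * (_ + X)]big1 ?addr0; last first.
  by move=> T neqT; rewrite prod_mixed_mx0.
congr (_ * _); apply: eq_bigr => i _.
by rewrite mxE (mem_imset _ _ perm_inj); case: ifP.
Qed.

(** * Increasing sequences, subsets and their listing permutations *)

Section IncSeq.
Context {m n : nat}.
Implicit Type a : incseq m n.

Lemma incseq_uniq a : uniq (val a).
Proof.
by rewrite -(map_inj_uniq val_inj); apply: (sorted_uniq ltn_trans ltnn (valP a)).
Qed.

Lemma incseq_leq a : (m <= n)%N.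
Proof.
rewrite -(size_tuple (val a)) -(card_uniqP (incseq_uniq a)) -[X in (_ <= X)%N]card_ord.
exact: max_card.
Qed.

Definition incset a : {set 'I_n} := [set i in val a].

Lemma card_incset a : #|incset a| = m.
Proof. by rewrite cardsE (card_uniqP (incseq_uniq a)) size_tuple. Qed.

Lemma incseq_tnth_lt a (i j : 'I_m) :
  (i < j)%N -> (tnth (val a) i < tnth (val a) j)%N.
Proof.
move=> ij; have [x0 _] : {x0 : 'I_n | true} by exists (tnth (val a) i).
rewrite !(tnth_nth x0) -!(nth_map x0 0%N val) ?size_tuple //.
by apply: (sorted_ltn_nth ltn_trans 0%N (valP a)) => //; rewrite inE size_map size_tuple.
Qed.

(** A strictly increasing sequence is determined by its set of members. *)
Lemma incset_inj : injective incset.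
Proof.
move=> a b /setP eqab; apply/val_inj/val_inj => /=.
apply: (inj_map val_inj); apply: (irr_sorted_eq ltn_trans ltnn).
- exact: (valP a).
- exact: (valP b).
by apply: eq_mem_map => i; have := eqab i; rewrite !inE.
Qed.

Lemma incset_codom (S : {set 'I_n}) : #|S| = m -> exists a, incset a = S.
Proof.
move=> cS; have sz : size (enum S) == m by rewrite -cardE cS.
have so : sorted ltn (map val (Tuple sz)).
  rewrite /= sorted_map /enum_mem; apply: sorted_filter.
    by move=> x y z; apply: ltn_trans.
  by rewrite -sorted_map -enumT val_enum_ord iota_ltn_sorted.
exists (exist _ (Tuple sz) so); apply/setP => i.
by rewrite inE; apply: mem_enum.
Qed.

(** [incset] is a bijection onto the subsets of cardinality [m]; this turns the sums over subsets
    into those of [expansion_coef]. *)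
Lemma sum_incset (V : nmodType) (F : {set 'I_n} -> V) :
  \sum_(S : {set 'I_n} | #|S| == m) F S = \sum_a F (incset a).
Proof.
rewrite -(big_imset _ (in2W incset_inj)); apply: eq_bigl => S.
apply/eqP/imsetP => [/incset_codom[a <-]|[a _ ->]]; last exact: card_incset.
by exists a.
Qed.

(** The list has length [n], so the default [i] is never returned; it is at hand even though ['I_n]
    may be empty for some [n]. *)
Definition shuffle_fun a (i : 'I_n) : 'I_n := nth i (val a ++ compl_seq a) i.

Lemma shuffle_size a : size (val a ++ compl_seq a) = n.
Proof.
by rewrite size_cat size_tuple (eqP (size_compl_seq a)) subnKC // (incseq_leq a).
Qed.

Lemma shuffle_fun_inj a : injective (shuffle_fun a).
Proof.
move=> i j; rewrite /shuffle_fun (set_nth_default i) ?shuffle_size // => /eqP.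
rewrite nth_uniq ?shuffle_size // => [/eqP/val_inj //|].
rewrite cat_uniq incseq_uniq filter_uniq ?enum_uniq // andbT /=.
by apply/hasPn => x; rewrite mem_filter => /andP[].
Qed.

Definition shuffle_perm a : {perm 'I_n} := perm (@shuffle_fun_inj a).

Lemma shuffle_permL a (e : (m + (n - m))%N = n) i :
  shuffle_perm a (cast_ord e (lshift _ i)) = tnth (val a) i.
Proof.
by rewrite permE /shuffle_fun nth_cat /= size_tuple ltn_ord; apply/esym/tnth_nth.
Qed.

Lemma shuffle_permR a (e : (m + (n - m))%N = n) i :
  shuffle_perm a (cast_ord e (rshift _ i)) = tnth (val (icompl a)) i.
Proof.
rewrite permE /shuffle_fun nth_cat /= size_tuple ltnNge leq_addr /= addKn.
by apply/esym/tnth_nth.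
Qed.

End IncSeq.

(** The added sum does not depend on [a], so it cancels when the signs for rows and columns are
    multiplied. *)
Lemma odd_shuffle_perm {m n : nat} (a : incseq m n) :
  odd_perm (shuffle_perm a) = odd (iweight a + \sum_(i < m) i.+1).
Proof.
have le_mn := incseq_leq a; have e := subnKC le_mn.
have wE i : widen_ord le_mn i = cast_ord e (lshift _ i) by apply/val_inj.
rewrite (odd_perm_shuffle m) //.
- rewrite big_ord_narrow -big_split /=.
  (* Passing to 1-based values and positions adds 2 to each summand. *)
  rewrite [in RHS](eq_bigr (fun i => shuffle_perm a (widen_ord le_mn i) + i + 2)%N).
    by rewrite [in RHS]big_split /= [in RHS]oddD big_const_seq iter_addn_0 oddM addbF.
  by move=> i _; rewrite wE shuffle_permL addn2 addSn addnS.
- move=> i j /andP[ij jm]; have im := ltn_trans ij jm.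
  have -> : i = cast_ord e (lshift _ (Ordinal im)) by apply/val_inj.
  have -> : j = cast_ord e (lshift _ (Ordinal jm)) by apply/val_inj.
  by rewrite !shuffle_permL incseq_tnth_lt.
- move=> i j /andP[mi ij]; have mj := leq_trans mi (ltnW ij).
  have hi : (i - m < n - m)%N by rewrite ltn_sub2r // (leq_ltn_trans mi).
  have hj : (j - m < n - m)%N by rewrite ltn_sub2r // (leq_ltn_trans mj).
  have -> : i = cast_ord e (rshift _ (Ordinal hi)).
    by apply/val_inj; rewrite /= subnKC.
  have -> : j = cast_ord e (rshift _ (Ordinal hj)).
    by apply/val_inj; rewrite /= subnKC.
  by rewrite !shuffle_permR incseq_tnth_lt //= ltn_sub2r // (leq_ltn_trans mi).
Qed.

Lemma incset_tnth {m n : nat} (a : incseq m n) i :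
  tnth (val a) i \in incset a.
Proof. by rewrite inE; apply: mem_tnth. Qed.

Lemma incset_tnth_icompl {m n : nat} (a : incseq m n) i :
  tnth (val (icompl a)) i \in incset a = false.
Proof.
rewrite inE; have := mem_tnth i (val (icompl a)).
by rewrite /= memtE mem_filter => /andP[/negPf].
Qed.

(** * Expansion in complementary minors and in powers of the scalar *)

Lemma det_mixed_mx {R : comNzRingType} {m n : nat} (A B : 'M[R]_n)
    (a b : incseq m n) :
  \det (mixed_mx A B (incset a) (incset b)) =
    (-1) ^+ (iweight a + iweight b)
      * \det (isubmx A a b) * \det (isubmx B (icompl a) (icompl b)).
Proof.
pose sg : R := (-1) ^+ (iweight a + iweight b).
have sgE : (-1) ^+ shuffle_perm a * (-1) ^+ shuffle_perm b = sg.
  rewrite /sg !odd_shuffle_perm !signr_odd -!exprD addnACA exprD addnn.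
  by rewrite -mul2n exprM sqrrN !expr1n mulr1.
have e := subnKC (incseq_leq a).
set M := mixed_mx _ _ _ _.
have detM : \det (mxsub (shuffle_perm a) (shuffle_perm b) M) =
    \det (isubmx A a b) * \det (isubmx B (icompl a) (icompl b)).
  apply: (det_diag_block e) => i j; rewrite !mxE ?shuffle_permL ?shuffle_permR
    ?incset_tnth ?incset_tnth_icompl ?mxE //.
(* The right-hand side becomes [sg * (sg * \det M)], and [sg] squares to 1. *)
rewrite -mulrA -detM det_mxsub_perm sgE mulrA -/sg -expr2 /sg -exprM.
by rewrite mulnC exprM sqrrN !expr1n mul1r.
Qed.

Lemma det_addmx_minors {R : comNzRingType} {n : nat} (A B : 'M[R]_n) :
  \det (A + B) = \sum_(r < n.+1) expansion_coef A B r.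
Proof.
(* Row sets are grouped by cardinality, which is at most [n], so [inord] is faithful. The index is
   then reversed because [expansion_coef A B r] uses sets of size [n - r]. *)
rewrite det_addmx_mixed (partition_big (fun S : {set 'I_n} => inord #|S| : 'I_n.+1) xpredT) //=.
rewrite (reindex_inj rev_ord_inj); apply: eq_bigr => r _ /=.
have cS (S : {set 'I_n}) : (inord #|S| == rev_ord r :> 'I_n.+1) = (#|S| == n - r)%N.
  rewrite -val_eqE /= inordK ?subSS // ltnS -[X in (_ <= X)%N]card_ord.
  exact: max_card.
rewrite (eq_bigl _ _ cS) sum_incset; apply: eq_bigr => a _.
rewrite (bigID (fun T : {set 'I_n} => #|T| == n - r)%N) /=.
rewrite sum_incset [X in _ + X]big1 ?addr0; last first.
  by move=> T neqT; rewrite det_mixed_mx0 ?card_incset.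
by apply: eq_bigr => b _; apply: det_mixed_mx.
Qed.

Lemma expansion_coefZ {R : comNzRingType} {n : nat} (A B : 'M[R]_n) (x : R)
    (r : nat) :
  (r <= n)%N -> expansion_coef A (x *: B) r = expansion_coef A B r * x ^+ r.
Proof.
move=> le_rn; rewrite [RHS]mulr_suml; apply: eq_bigr => a _.
rewrite [RHS]mulr_suml; apply: eq_bigr => b _; rewrite -!mulrA; do 2!congr (_ * _).
have -> : isubmx (x *: B) (icompl a) (icompl b) =
    x *: isubmx B (icompl a) (icompl b) by apply/matrixP => i j; rewrite !mxE.
(* The minor of [B] has size [n - (n - r)], which is [r] since [r <= n]. *)
by rewrite detZ mulrC; congr (_ * x ^+ _); apply: subKn.
Qed.

Lemma expansion_coef0 {R : comNzRingType} {n : nat} (A B : 'M[R]_n) :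
  expansion_coef A B 0 = \det A.
Proof.
have := det_addmx_minors A (0 *: B); rewrite scale0r addr0 => ->.
(* Writing the zero matrix as [0 *: B] exposes the factor [0 ^+ r], which is 1 at [r = 0] and kills
   the other terms. *)
rewrite -(scale0r B) big_ord_recl big1 /= ?expansion_coefZ ?expr0 ?mulr1 ?addr0 //.
by move=> i _; rewrite expansion_coefZ ?expr0n ?mulr0 //; apply: (ltn_ord i).
Qed.

Lemma det_mx_dim0 {R : comNzRingType} {p : nat} (A : 'M[R]_p) :
  p = 0%N -> \det A = 1.
Proof. by move=> p0; subst p; apply: det_mx00. Qed.

(** At [r = n] the minors of [A] are empty with determinant 1, so [A] may be replaced by 0; all
    minors of 0 of positive size vanish. *)
Lemma expansion_coef_last {R : comNzRingType} {n : nat} (A B : 'M[R]_n) :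
  expansion_coef A B n = \det B.
Proof.
have := det_addmx_minors 0 B; rewrite add0r => ->.
rewrite big_ord_recr big1 /= ?add0r.
  apply: eq_bigr => a _; apply: eq_bigr => b _.
  by rewrite !(det_mx_dim0 (isubmx _ a b)) ?subnn.
move=> i _; apply: big1 => a _; apply: big1 => b _.
have -> : isubmx 0 a b = 0 :> 'M[R]_(n - i) by apply/matrixP => j k; rewrite !mxE.
have : (0 < n - i)%N by rewrite subn_gt0.
by move: (n - i)%N a b => [|p] a b // _; rewrite det0 mulr0 mul0r.
Qed.

Lemma det_addZ {R : comNzRingType} {n : nat} (A B : 'M[R]_n) (x : R) :
    (0 < n)%N ->
  \det (A + x *: B) =
    \det A + \sum_(1 <= r < n) expansion_coef A B r * x ^+ r + x ^+ n * \det B.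
Proof.
move=> n_gt0; rewrite det_addmx_minors -(big_mkord xpredT (expansion_coef A _)).
rewrite big_nat_recr //= (big_ltn n_gt0) expansion_coef0.
rewrite expansion_coefZ // expansion_coef_last [x ^+ n * _]mulrC.
congr (_ + _ + _); apply: eq_big_nat => r /andP[_ /ltnW].
exact: expansion_coefZ.
Qed.

(** * Closure properties of polynomial functions *)

Section PolynomialFun.
Context {R : comNzRingType}.
Implicit Types f g : R -> R.

Lemma polynomial_fun_ext {f g} : polynomial_fun f -> f =1 g -> polynomial_fun g.
Proof. by move=> /[swap] fg [p pE]; exists p => x; rewrite -fg pE. Qed.

Lemma polynomial_fun_cst c : polynomial_fun (fun _ : R => c).
Proof. by exists c%:P => x; rewrite hornerC. Qed.

Lemma polynomial_fun_exp r : polynomial_fun (fun x : R => x ^+ r).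
Proof. by exists 'X^r => x; rewrite hornerXn. Qed.

Lemma polynomial_fun_add {f g} :
  polynomial_fun f -> polynomial_fun g -> polynomial_fun (fun x => f x + g x).
Proof. by move=> [p pE] [q qE]; exists (p + q) => x; rewrite hornerD pE qE. Qed.

Lemma polynomial_fun_opp {f} :
  polynomial_fun f -> polynomial_fun (fun x => - f x).
Proof. by move=> [p pE]; exists (- p) => x; rewrite hornerN pE. Qed.

Lemma polynomial_fun_mul {f g} :
  polynomial_fun f -> polynomial_fun g -> polynomial_fun (fun x => f x * g x).
Proof. by move=> [p pE] [q qE]; exists (p * q) => x; rewrite hornerM pE qE. Qed.

Lemma polynomial_fun_sum {I : Type} (r : seq I) {F : I -> R -> R} :
    (forall i, polynomial_fun (F i)) ->
  polynomial_fun (fun x => \sum_(i <- r) F i x).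
Proof.
move=> hF; elim: r => [|i r IHr].
  by apply: (polynomial_fun_ext (polynomial_fun_cst 0)) => x; rewrite big_nil.
apply: (polynomial_fun_ext (polynomial_fun_add (hF i) IHr)) => x.
by rewrite big_cons.
Qed.

Lemma polynomial_fun_prod {I : Type} (r : seq I) {F : I -> R -> R} :
    (forall i, polynomial_fun (F i)) ->
  polynomial_fun (fun x => \prod_(i <- r) F i x).
Proof.
move=> hF; elim: r => [|i r IHr].
  by apply: (polynomial_fun_ext (polynomial_fun_cst 1)) => x; rewrite big_nil.
apply: (polynomial_fun_ext (polynomial_fun_mul (hF i) IHr)) => x.
by rewrite big_cons.
Qed.

Lemma polynomial_fun_det {p : nat} {M : R -> 'M[R]_p} :
    (forall i j, polynomial_fun (fun x => M x i j)) ->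
  polynomial_fun (fun x => \det (M x)).
Proof.
move=> hM; apply: polynomial_fun_sum => s.
by apply: (polynomial_fun_mul (polynomial_fun_cst _) (polynomial_fun_prod _ _)).
Qed.

Lemma polynomial_fun_expansion_coef (n : nat) (A : 'M[R]_n) (B : R -> 'M[R]_n)
    (r : nat) :
    (forall i j, polynomial_fun (fun x => B x i j)) ->
  polynomial_fun (fun x => expansion_coef A (B x) r).
Proof.
move=> hB; apply: polynomial_fun_sum => a; apply: polynomial_fun_sum => b.
apply: (polynomial_fun_mul (polynomial_fun_cst _) _).
apply: polynomial_fun_det => i j.
by apply: (polynomial_fun_ext (hB _ _)) => x; rewrite mxE.
Qed.

End PolynomialFun.

(** * Factorized form of the dispersion relation *)

Theorem mainTheorem2 (R : comNzRingType) (K W : Type) (n1 n2 : nat)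
    (hn : (2 <= n1 + n2)%N)
    (Lam1 : K -> W -> 'M[R]_n1) (Lam2 : K -> W -> 'M[R]_n2)
    (B : K -> W -> R -> 'M[R]_(n1 + n2))
    (hB : forall k w i j, polynomial_fun (fun b => B k w b i j)) :
  let n := (n1 + n2)%N in
  let Lam k w := block_mx (Lam1 k w) 0 0 (Lam2 k w) in
  let M k w b := Lam k w + b *: B k w b in
  let G1 k w := \det (Lam1 k w) in
  let G2 k w := \det (Lam2 k w) in
  let c k w b r := expansion_coef (Lam k w) (B k w b) r in
  let rest k w b :=
    \sum_(1 <= r < n) c k w b r * b ^+ r + b ^+ n * \det (B k w b) in
  [/\ (forall k w, \det (Lam k w) = G1 k w * G2 k w),
      (forall k w b,
         \det (M k w b) =
           \det (Lam k w) + \sum_(1 <= r < n) c k w b r * b ^+ r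
             + b ^+ n * \det (B k w b)),
      (exists Gc : K -> W -> R -> R,
         [/\ (forall k w, polynomial_fun (Gc k w)),
             (forall k w b, rest k w b = - (b * Gc k w b)),
             (forall k w b,
                \det (M k w b) = G1 k w * G2 k w - b * Gc k w b)
           & (forall k w b,
                \det (M k w b) = 0 <-> G1 k w * G2 k w = b * Gc k w b)])
    & (forall k w,
         [/\ M k w 0 = Lam k w,
             rest k w 0 = 0
           & \det (M k w 0) = 0 <-> G1 k w * G2 k w = 0])].
Proof.
move=> n Lam M G1 G2 c rest.
have n_gt0 : (0 < n)%N by apply: ltnW.
have detLam k w : \det (Lam k w) = G1 k w * G2 k w by apply: det_ublock.
have expM k w b : \det (M k w b) = \det (Lam k w)
    + \sum_(1 <= r < n) c k w b r * b ^+ r + b ^+ n * \det (B k w b).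
  exact: det_addZ.
(* Every term of [rest] contains a factor [b], since [r] and [n] are positive. Lowering each
   exponent by one removes it without division, and the sign accounts for moving [rest] across the
   equation. *)
pose Gc k w b :=
  - (\sum_(1 <= r < n) c k w b r * b ^+ r.-1 + b ^+ n.-1 * \det (B k w b)).
have restE k w b : rest k w b = - (b * Gc k w b).
  rewrite /rest /Gc mulrN opprK mulrDr mulrA -exprS prednK //.
  congr (_ + _). rewrite mulr_sumr; apply: eq_big_nat => r /andP[r_gt0 _].
  by rewrite mulrCA -exprS prednK.
have detM k w b : \det (M k w b) = G1 k w * G2 k w - b * Gc k w b.
  by rewrite expM detLam -addrA -restE.
split=> //.
- exists Gc; split=> // [k w|k w b].
    apply/polynomial_fun_opp/polynomial_fun_add; last first.
      exact: polynomial_fun_mul (polynomial_fun_exp _) (polynomial_fun_det _).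
    apply: polynomial_fun_sum => r; apply: (polynomial_fun_mul _ (polynomial_fun_exp _)).
    exact: polynomial_fun_expansion_coef.
  by rewrite detM; split=> [/subr0_eq //|->]; rewrite subrr.
- move=> k w; split; first by rewrite /M scale0r addr0.
    by rewrite restE mul0r oppr0.
  by rewrite detM mul0r subr0.
Qed.
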